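(* Every BD triad is affine equivalent to a reduced BD triad. That is, for every BD triad $A,A',A''$ on $V$ there exists a reduced BD triad $B,B',B''$ on $V$ such that $A,A',A''$ is affine equivalent to $B,B',B''$.
   Context: $\mathbb{K}$ is an algebraically closed field of characteristic zero and $V$ is a vector space over $\mathbb{K}$ with finite positive dimension. For linear transformations $X,Y:V\to V$, $[X,Y]:=XY-YX$. A bidiagonal triad (BD triad) on $V$ is an ordered triple of linear transformations $A,A',A'':V\to V$ such that: (i) Each of $A,A',A''$ is diagonalizable. (ii) There exist an ordering $\{V_i\}_{i=0}^d$ (resp. $\{V'_i\}_{i=0}^D$) (resp. $\{V''_i\}_{i=0}^\delta$) of the eigenspaces of $A$ (resp. $A'$) (resp. $A''$), each eigenspace listed exactly once, with $A'V_i\subseteq V_i+V_{i+1}$ and $A''V_i\subseteq V_i+V_{i+1}$ for $0\le i\le d$; $A''V'_i\subseteq V'_i+V'_{i+1}$ and $AV'_i\subseteq V'_i+V'_{i+1}$ for $0\le i\le D$; $AV''_i\subseteq V''_i+V''_{i+1}$ and $A'V''_i\subseteq V''_i+V''_{i+1}$ for $0\le i\le\delta$; where $V_{d+1}=V'_{D+1}=V''_{\delta+1}=0$. (iii) The following restrictions are bijections: $[A',A]^{d-2i}|_{V_i}:V_i\to V_{d-i}$ and $[A'',A]^{d-2i}|_{V_i}:V_i\to V_{d-i}$ for $0\le i\le d/2$; $[A'',A']^{D-2i}|_{V'_i}:V'_i\to V'_{D-i}$ and $[A,A']^{D-2i}|_{V'_i}:V'_i\to V'_{D-i}$ for $0\le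 i\le D/2$; $[A,A'']^{\delta-2i}|_{V''_i}:V''_i\to V''_{\delta-i}$ and $[A',A'']^{\delta-2i}|_{V''_i}:V''_i\to V''_{\delta-i}$ for $0\le i\le\delta/2$. It is known that $d=D=\delta$ for any BD triad; this common value $d$ is the diameter. The orderings in (ii) are uniquely determined by the BD triad and are called the standard orderings. Let $\theta_i$ (resp. $\theta'_i$) (resp. $\theta''_i$) be the eigenvalue of $A$ (resp. $A'$) (resp. $A''$) on $V_i$ (resp. $V'_i$) (resp. $V''_i$) for the standard orderings; these are the first, second, and third eigenvalue sequences of $A,A',A''$. The BD triad is reduced if its first, second, and third eigenvalue sequences are each $\{2i-d\}_{i=0}^d$. For linear transformations $X,Y:V\to V$, $X$ is affine equivalent to $Y$, written $X\sim Y$, if there exist $r,s\in\mathbb{K}$ with $r\ne 0$ and $X=rY+sI$. A BD triad $A,A',A''$ on $V$ is affine equivalent to a BD triad $B,B',B''$ on $V$ if $A\sim B$, $A'\sim B'$, and $A''\sim B''$. *)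

(* Defs.v *)
From HB Require Import structures.
From mathcomp Require Import all_boot all_order all_algebra.

Set Implicit Arguments.
Unset Strict Implicit.
Unset Printing Implicit Defensive.

Import GRing.Theory.
Local Open Scope ring_scope.

(* 'End(V) carries no canonical ring structure, so products and powers of
   linear maps are spelled out with composition. The infix \o associates at the
   same level as + and -, so the parentheses below matter. *)
Definition lfun_comm (K : fieldType) (V : vectType K) (X Y : 'End(V)) :
    'End(V) :=
  ((X \o Y) - (Y \o X))%VF.

Definition lfun_pow (K : fieldType) (V : vectType K) (X : 'End(V)) (n : nat) :
    'End(V) :=
  iter n (comp_lfun X) \1%VF.

Definition lfun_diagonalizable (K : fieldType) (V : vectType K) (X : 'End(V)) :
    Prop :=
  exists2 b : seq V, basis_of fullv b &
    forall v, v \in b -> exists a : K, X v = a *: v.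

Definition eigenspace_ordering (K : fieldType) (V : vectType K) (X : 'End(V))
    (Vs : seq {vspace V}) : Prop :=
  uniq Vs /\
  forall U : {vspace V},
    U \in Vs <-> exists2 a : K, passmx.leigenvalue X a & U = passmx.leigenspace X a.

Definition restr_bij (K : fieldType) (V : vectType K) (f : 'End(V))
    (U W : {vspace V}) : Prop :=
  (f @: U)%VS = W /\ {in U &, injective f}.

(* An ordering V_0, ..., V_d is a sequence of length d + 1. *)
Definition ordering_diam (K : fieldType) (V : vectType K)
    (Vs : seq {vspace V}) : nat :=
  (size Vs).-1.

(* The default value of nth provides the convention V_(d+1) = 0. *)
Definition raises (K : fieldType) (V : vectType K) (Y : 'End(V))
    (Vs : seq {vspace V}) : Prop :=
  forall i : nat, (i <= ordering_diam Vs)%N ->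
    (Y @: nth 0%VS Vs i <= nth 0%VS Vs i + nth 0%VS Vs i.+1)%VS.

Definition comm_bij (K : fieldType) (V : vectType K) (Y X : 'End(V))
    (Vs : seq {vspace V}) : Prop :=
  forall i : nat, (i.*2 <= ordering_diam Vs)%N ->
    restr_bij (lfun_pow (lfun_comm Y X) (ordering_diam Vs - i.*2))
      (nth 0%VS Vs i) (nth 0%VS Vs (ordering_diam Vs - i)).

(* The conditions on the eigenspaces of one member X of a triad, Y and Z being
   the two other members; they are symmetric in Y and Z. *)
Definition standard_ordering (K : fieldType) (V : vectType K)
    (X Y Z : 'End(V)) (Vs : seq {vspace V}) : Prop :=
  [/\ eigenspace_ordering X Vs,
      raises Y Vs /\ raises Z Vs
    & comm_bij Y X Vs /\ comm_bij Z X Vs].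

Definition standard_orderings (K : fieldType) (V : vectType K)
    (A A' A'' : 'End(V)) (Vs Vs' Vs'' : seq {vspace V}) : Prop :=
  [/\ standard_ordering A A' A'' Vs,
      standard_ordering A' A'' A Vs'
    & standard_ordering A'' A A' Vs''].

Definition BD_triad (K : fieldType) (V : vectType K) (A A' A'' : 'End(V)) :
    Prop :=
  [/\ lfun_diagonalizable A, lfun_diagonalizable A', lfun_diagonalizable A''
    & exists Vs Vs' Vs'' : seq {vspace V},
        standard_orderings A A' A'' Vs Vs' Vs''].

Definition eigenvalue_seq (K : fieldType) (V : vectType K) (X : 'End(V))
    (Vs : seq {vspace V}) (theta : seq K) : Prop :=
  Vs = [seq passmx.leigenspace X a | a <- theta].

(* The standard orderings of a triad are unique, so "exists" and "for all"
   standard orderings have the same meaning here. *)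
Definition reduced_BD_triad (K : fieldType) (V : vectType K)
    (A A' A'' : 'End(V)) : Prop :=
  BD_triad A A' A'' /\
  exists (Vs Vs' Vs'' : seq {vspace V}) (d : nat),
    let theta := mkseq (fun i => (i.*2)%:R - d%:R : K) d.+1 in
    [/\ standard_orderings A A' A'' Vs Vs' Vs'',
        eigenvalue_seq A Vs theta,
        eigenvalue_seq A' Vs' theta
      & eigenvalue_seq A'' Vs'' theta].

Definition affine_equiv (K : fieldType) (V : vectType K) (X Y : 'End(V)) :
    Prop :=
  exists r s : K, r != 0 /\ X = r *: Y + s *: \1%VF.

Definition triad_affine_equiv (K : fieldType) (V : vectType K)
    (A A' A'' B B' B'' : 'End(V)) : Prop :=
  [/\ affine_equiv A B, affine_equiv A' B' & affine_equiv A'' B''].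

(* Main.v *)
(* The operator N = [A', A] raises both the eigenspaces of A and those of A', and
   N^d is injective on the first eigenspace of each; so d is determined by the
   nilpotency index of N, whence the diameters agree. Following a vector of the
   first eigenspace of A along its N-string, and comparing with its components
   in the eigenspaces of A', shows that
   (theta_(i+1) - theta_i) (theta'_(i+1) - theta'_i) does not depend on i.
   Combining this for the three pairs of the triad, the squared gaps
   (theta_(i+1) - theta_i)^2 are constant. Two consecutive gaps cannot be
   opposite, as theta_(i+2) <> theta_i, so each eigenvalue sequence is an
   arithmetic progression, which an affine map sends to 2i - d. *)
Require Import Defs.
From HB Require Import structures.
From mathcomp Require Import all_boot all_order all_algebra.
From mathcomp Require Import ring.
Import GRing.Theory.
Local Open Scope ring_scope.

Set Implicit Arguments.
Unset Strict Implicit.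
Unset Printing Implicit Defensive.

(** * Powers and commutators of endomorphisms *)

Lemma lfun_pow0E (K : fieldType) (V : vectType K) (N : 'End(V)) v :
  lfun_pow N 0 v = v.
Proof. exact: id_lfunE. Qed.

Lemma lfun_powSE (K : fieldType) (V : vectType K) (N : 'End(V)) i v :
  lfun_pow N i.+1 v = N (lfun_pow N i v).
Proof. by rewrite /lfun_pow iterS comp_lfunE. Qed.

Lemma lfun_powSrE (K : fieldType) (V : vectType K) (N : 'End(V)) i v :
  lfun_pow N i.+1 v = lfun_pow N i (N v).
Proof.
elim: i => [|i IHi]; first by rewrite lfun_powSE !lfun_pow0E.
by rewrite lfun_powSE IHi -lfun_powSE.
Qed.

Lemma lfun_powZ (K : fieldType) (V : vectType K) (c : K) (N : 'End(V)) i :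
  lfun_pow (c *: N) i = c ^+ i *: lfun_pow N i.
Proof.
apply/lfunP => v; elim: i => [|i IHi]; first by rewrite expr0 scale1r.
by rewrite lfun_powSE IHi !scale_lfunE lfun_powSE linearZ scalerA exprS.
Qed.

Lemma lfun_commE (K : fieldType) (V : vectType K) (X Y : 'End(V)) v :
  lfun_comm X Y v = X (Y v) - Y (X v).
Proof. by rewrite /lfun_comm add_lfunE opp_lfunE !comp_lfunE. Qed.

Lemma lfun_commC (K : fieldType) (V : vectType K) (X Y : 'End(V)) :
  lfun_comm X Y = (-1) *: lfun_comm Y X.
Proof.
by apply/lfunP => v; rewrite scale_lfunE !lfun_commE scaleN1r opprB.
Qed.

(** * Eigenspace decompositions and their projections *)

Lemma mem_leigenspace (K : fieldType) (V : vectType K) (X : 'End(V)) a v :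
  (v \in passmx.leigenspace X a) = (X v == a *: v).
Proof.
by rewrite memv_ker add_lfunE opp_lfunE scale_lfunE id_lfunE subr_eq0.
Qed.

(** Applying [X] minus [theta n] to the sum kills the last term and multiplies each other [w k] by
    the nonzero scalar [theta k - theta n], so induction on [n] applies. *)
Lemma eigenvectors_sum_eq0 (K : fieldType) (V : vectType K) (X : 'End(V))
    (theta : nat -> K) n (w : nat -> V) :
  {in gtn n &, injective theta} ->
  (forall k, (k < n)%N -> X (w k) = theta k *: w k) ->
  \sum_(k < n) w k = 0 -> forall k, (k < n)%N -> w k = 0.
Proof.
elim: n w => [|n IHn] w theta_inj Xw sum0; first by [].
have w0 k : (k < n)%N -> w k = 0.
  move=> ltkn; apply/eqP.
  have: (theta k - theta n) *: w k == 0.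
    apply/eqP; apply: (IHn (fun k => (theta k - theta n) *: w k)) ltkn.
    - by move=> i j lti ltj; apply: theta_inj; rewrite inE ltnW // ltnS.
    - by move=> i lti; rewrite linearZ /= Xw 1?ltnW // scalerA mulrC -scalerA.
    have := congr1 (fun v => X v - theta n *: v) sum0.
    rewrite linear0 scaler0 subrr big_ord_recr /= linearD /= linear_sum /=.
    rewrite scalerDr scaler_sumr Xw // opprD addrACA subrr addr0 -sumrB => sum0'.
    rewrite -[RHS]sum0'; apply: eq_bigr => i _.
    by rewrite Xw 1?ltnW // ?ltnS // scalerBl.
  rewrite scaler_eq0 subr_eq0 => /orP[/eqP theta_eq|//].
  by move: (ltkn); rewrite (theta_inj k n) ?ltnn // inE ltnS // ltnW.
move=> k; rewrite ltnS leq_eqVlt => /orP[/eqP ->|]; last exact: w0.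
by move: sum0; rewrite big_ord_recr /= big1 ?add0r // => i _; rewrite w0.
Qed.

(** The subspaces are indexed by all natural numbers and vanish from [n] on, which encodes V_(d+1) =
    0. The [E i] are the projections; that [E i] acts on [U j] as the identity or as 0 is derived
    from the fields. *)
Record eigen_grading (K : fieldType) (V : vectType K) (X : 'End(V)) (n : nat)
    (U : nat -> {vspace V}) (theta : nat -> K) (E : nat -> 'End(V)) : Prop :=
  EigenGrading {
    grading_inj : {in gtn n &, injective theta};
    grading_eigen : forall i v, v \in U i -> X v = theta i *: v;
    grading_default : forall i, (n <= i)%N -> U i = 0%VS;
    grading_mem : forall i v, E i v \in U i;
    grading_sum : forall v, \sum_(i < n) E i v = v }.

Definition raising (K : fieldType) (V : vectType K) (N : 'End(V))
    (U : nat -> {vspace V}) : Prop :=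
  forall i v, v \in U i -> N v \in U i.+1.

(** The vectors [E i v], with [v] subtracted when i = j, are eigenvectors for distinct eigenvalues
    and add up to 0, so each of them vanishes. *)
Lemma grading_proj (K : fieldType) (V : vectType K) (X : 'End(V)) n U theta E :
  eigen_grading X n U theta E -> forall i j v, v \in U j ->
  E i v = if i == j then v else 0.
Proof.
move=> gr i j v Uv.
have [lejn|ltjn] := leqP n j.
  move: Uv; rewrite (grading_default gr) // memv0 => /eqP ->.
  by rewrite linear0 if_same.
have [lein|ltin] := leqP n i.
  have := grading_mem gr i v; rewrite (grading_default gr) // memv0 => /eqP ->.
  by case: eqP lein ltjn => // ->; rewrite leqNgt => /negbTE ->.
apply/eqP; rewrite -subr_eq0; apply/eqP.
apply: (@eigenvectors_sum_eq0 _ _ X theta n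
  (fun i => E i v - (if i == j then v else 0))) => //.
- exact: grading_inj gr.
- move=> k _; apply: (grading_eigen gr); rewrite rpredB ?(grading_mem gr) //.
  by case: eqP => [->|_]; rewrite ?mem0v.
rewrite sumrB (grading_sum gr) (bigD1 (Ordinal ltjn)) //= eqxx big1 ?addr0 ?subrr //.
by move=> k; rewrite -val_eqE /= => /negbTE ->.
Qed.

Lemma grading_proj_eigen (K : fieldType) (V : vectType K) (X : 'End(V)) n U
    theta E : eigen_grading X n U theta E ->
  forall i v, E i (X v) = theta i *: E i v.
Proof.
move=> gr i v; rewrite -[in LHS](grading_sum gr v) !linear_sum /=.
rewrite -[in RHS](grading_sum gr v) linear_sum scaler_sumr /=.
apply: eq_bigr => j _; have Uj := grading_mem gr j v.
rewrite (grading_eigen gr Uj) linearZ /= !(grading_proj gr _ Uj).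
by case: eqP => [->|_]; rewrite ?scaler0.
Qed.

(** * Raising maps and the product of eigenvalue gaps *)

Lemma grading_proj_raising (K : fieldType) (V : vectType K) (X N : 'End(V)) n U
    theta E : eigen_grading X n U theta E -> raising N U ->
  forall i v, E i.+1 (N v) = N (E i v).
Proof.
move=> gr rN i v; rewrite -[in LHS](grading_sum gr v) !linear_sum /=.
rewrite -[in RHS](grading_sum gr v) !linear_sum /=; apply: eq_bigr => j _.
have Uj := grading_mem gr j v.
rewrite (grading_proj gr _ Uj) (grading_proj gr _ (rN _ _ Uj)) eqSS.
by case: eqP; rewrite ?linear0.
Qed.

Lemma grading_proj0_raising (K : fieldType) (V : vectType K) (X N : 'End(V)) n U
    theta E : eigen_grading X n U theta E -> raising N U ->
  forall v, E 0%N (N v) = 0.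
Proof.
move=> gr rN v; rewrite -(grading_sum gr v) !linear_sum /= big1 // => j _.
by rewrite (grading_proj gr _ (rN _ _ (grading_mem gr j v))).
Qed.

Lemma grading_proj_raising_pow (K : fieldType) (V : vectType K)
    (X N : 'End(V)) n U theta E :
  eigen_grading X n U theta E -> raising N U -> forall j i v,
  E i (lfun_pow N j v) = if (j <= i)%N then lfun_pow N j (E (i - j)%N v) else 0.
Proof.
move=> gr rN; elim=> [|j IHj] i v; first by rewrite subn0 !lfun_pow0E.
rewrite lfun_powSE; case: i => [|i]; first exact: grading_proj0_raising gr rN _.
rewrite (grading_proj_raising gr rN) IHj ltnS subSS.
by case: ifP; rewrite ?linear0 // lfun_powSE.
Qed.

Lemma raising_pow (K : fieldType) (V : vectType K) (N : 'End(V)) U :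
  raising N U -> forall j i v, v \in U i -> lfun_pow N j v \in U (i + j)%N.
Proof.
move=> rN; elim=> [|j IHj] i v Uv; first by rewrite lfun_pow0E addn0.
by rewrite lfun_powSE addnS rN ?IHj.
Qed.

Lemma raising_pow_eq0 (K : fieldType) (V : vectType K) (X N : 'End(V)) n U
    theta E : eigen_grading X n U theta E -> raising N U ->
  forall j v, (n <= j)%N -> lfun_pow N j v = 0.
Proof.
move=> gr rN j v lenj; rewrite -(grading_sum gr v) linear_sum big1 // => i _.
have := raising_pow rN j (grading_mem gr i v).
by rewrite (grading_default gr) ?(leq_trans lenj) ?leq_addl // memv0 => /eqP.
Qed.

(** The power N^d shifts degrees by d, so among the degrees 0, ..., d only the component of degree 0
    can survive. *)
Lemma raising_top_pow_eq0 (K : fieldType) (V : vectType K) (X N : 'End(V)) d U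
    theta E : eigen_grading X d.+1 U theta E -> raising N U ->
  forall v, E 0%N v = 0 -> lfun_pow N d v = 0.
Proof.
move=> gr rN v Ev0; rewrite -(grading_sum gr (lfun_pow N d v)) big1 // => i _.
rewrite (grading_proj_raising_pow gr rN); case: ifP => // ledi.
have -> : i = d :> nat by apply/eqP; rewrite eqn_leq ledi -ltnS ltn_ord.
by rewrite subnn Ev0 linear0.
Qed.

(* Take v in the first eigenspace of X and let w_k be its component in the k-th
   eigenspace of Y. As N^d is injective on U_0 and kills the components w_k with
   k > 0, Y v = eta_0 v + delta_0 N v, which reads
   (eta_(k+1) - eta_0) w_(k+1) = delta_0 N w_k. Hence
   x = Y (N^i v) - delta_i N^(i+1) v - eta_i N^i v lies both in U_i and in the
   image of N^(i+1), so x = 0, and the component of x in the (i+1)-st eigenspace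
   of Y is the claimed identity times N^(i+1) w_0. *)
Lemma eigenvalue_gap_product (K : fieldType) (V : vectType K)
    (X Y N : 'End(V)) d U W (theta eta delta : nat -> K) E F v :
  eigen_grading X d.+1 U theta E -> eigen_grading Y d.+1 W eta F ->
  raising N U -> raising N W ->
  (forall i x, (i < d)%N -> x \in U i -> Y x - delta i *: N x \in U i) ->
  (forall x, x \in U 0%N -> lfun_pow N d x = 0 -> x = 0) ->
  v \in U 0%N -> v != 0 ->
  forall i, (i < d)%N ->
  (eta i.+1 - eta i) * delta 0%N = delta i * (eta 1%N - eta 0%N).
Proof.
move=> grX grY rU rW Ydelta Ninj Uv v0 i ltid.
have d_gt0 : (0 < d)%N by apply: leq_trans ltid.
(* The difference of [v] and w_0 has no component in the first eigenspace of [Y], so N^d takes the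
   same value on both. *)
have Nd0 : lfun_pow N d (F 0%N v) != 0.
  apply: contra v0 => /eqP Nu0; apply/eqP/Ninj => //.
  have: lfun_pow N d (v - F 0%N v) = 0.
    apply: (raising_top_pow_eq0 grY rW).
    by rewrite linearB /= (grading_proj grY _ (grading_mem grY _ _)) subrr.
  by rewrite linearB /= Nu0 subr0.
have Yv : Y v = eta 0%N *: v + delta 0%N *: N v.
  apply/eqP; rewrite -subr_eq0 opprD addrA addrAC; apply/eqP/Ninj.
    by rewrite rpredB ?rpredZ // Ydelta.
  apply: (raising_top_pow_eq0 grY rW); rewrite !linearB !linearZ /=.
  rewrite (grading_proj_eigen grY) (grading_proj0_raising grY rW).
  by rewrite oppr0 scaler0 addr0 scalerN subrr.
have Fv k : (eta k.+1 - eta 0%N) *: F k.+1 v = delta 0%N *: N (F k v).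
  rewrite scalerBl -(grading_proj_eigen grY) Yv linearD !linearZ /=.
  by rewrite (grading_proj_raising grY rW) scalerN addrAC subrr add0r.
pose x := Y (lfun_pow N i v) - delta i *: lfun_pow N i.+1 v
          - eta i *: lfun_pow N i v.
have Ux : x \in U i.
  have Ui : lfun_pow N i v \in U i by apply: (raising_pow rU i Uv).
  by rewrite rpredB ?rpredZ // lfun_powSE Ydelta.
have Fx k : F k x = (eta k - eta i) *: F k (lfun_pow N i v)
                    - delta i *: F k (lfun_pow N i.+1 v).
  by rewrite !linearB !linearZ /= (grading_proj_eigen grY) scalerBl !scalerN addrAC.
(* The part of x in U_i is read off one [Y]-component at a time. For k < i both powers of [N]
   contribute 0; for k > i, [Fv] turns N^i w_(k-i) into a multiple of N^(i+1) w_(k-i-1), which has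
   no part in U_i; for k = i the factor [eta k - eta i] is 0. *)
have EFx k : (k < d.+1)%N -> E i (F k x) = 0.
  move=> ltkd; rewrite Fx !(grading_proj_raising_pow grY rW).
  case: (ltngtP k i) => [_|ltik|->].
  - by rewrite !scaler0 subr0 linear0.
  - have E0 y : E i (lfun_pow N i.+1 y) = 0.
      by rewrite (grading_proj_raising_pow grX rU) ltnn.
    rewrite linearB !linearZ /= E0 oppr0 scaler0 addr0.
    have eta0 : eta (k - i)%N - eta 0%N != 0.
      rewrite subr_eq0; apply: contraTneq ltik => /(grading_inj grY) eq0.
      rewrite -leqNgt -subn_eq0 eq0 //= inE.
      exact: leq_ltn_trans (leq_subr _ _) ltkd.
    have := Fv (k - i).-1; rewrite prednK ?subn_gt0 //.
    move/(canRL (scalerK eta0)) ->.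
    by rewrite !linearZ /= -lfun_powSrE E0 !scaler0.
  - by rewrite subrr scale0r scaler0 subr0 linear0.
have x0 : x = 0.
  have := grading_proj grX i Ux; rewrite eqxx => <-.
  by rewrite -(grading_sum grY x) linear_sum big1 // => k _; apply: EFx.
have NSu : lfun_pow N i.+1 (F 0%N v) != 0.
  apply: contra Nd0 => /eqP Nu0; rewrite -(subnK ltid).
  elim: (d - _)%N => [|j IHj]; first by rewrite Nu0.
  by rewrite addSn lfun_powSE (eqP IHj) linear0.
(* [NF1] expresses N^i w_1 through N^(i+1) w_0, so the difference of the two sides of the goal
   annihilates the nonzero vector N^(i+1) w_0. *)
have := Fx i.+1; rewrite x0 linear0 !(grading_proj_raising_pow grY rW) leqnSn leqnn.
rewrite subSnn subnn => /esym/eqP; rewrite subr_eq0 => /eqP eqF.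
have NF1 : (eta 1%N - eta 0%N) *: lfun_pow N i (F 1%N v) =
           delta 0%N *: lfun_pow N i.+1 (F 0%N v).
  by have := congr1 (lfun_pow N i) (Fv 0%N); rewrite !linearZ /= -lfun_powSrE.
apply/eqP; rewrite -subr_eq0; apply: contraNT NSu => ne0.
rewrite -[_ == 0]/(false || _) -(negbTE ne0) -scaler_eq0.
by rewrite scalerBl [delta i * _]mulrC -!scalerA -NF1 -eqF !scalerA mulrC subrr.
Qed.

(** * Gradings attached to orderings of eigenspaces *)

Lemma eigenspace_ordering_eigenvalues (K : fieldType) (V : vectType K)
    (X : 'End(V)) Vs : eigenspace_ordering X Vs ->
  exists theta : seq K,
    [/\ Vs = [seq passmx.leigenspace X a | a <- theta], uniq theta
      & forall a, a \in theta -> passmx.leigenvalue X a].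
Proof.
case=> uVs VsP.
have: forall U, U \in Vs ->
    exists2 a, passmx.leigenvalue X a & U = passmx.leigenspace X a.
  by move=> U /VsP.
elim: Vs uVs {VsP} => [_ _|U Vs IHVs /= /andP[UVs uVs] eigVs].
  by exists [::].
have [a eig_a Ua] := eigVs U (mem_head _ _).
have [W VsW|theta [Vs_eq uth eigth]] := IHVs uVs.
  by apply: eigVs; rewrite inE VsW orbT.
exists (a :: theta); split=> [||b] /=; first by rewrite Ua Vs_eq.
  rewrite uth andbT; apply: contra UVs => th_a.
  by rewrite Ua Vs_eq map_f.
by rewrite inE => /predU1P[->//|/eigth].
Qed.

(** Each nonzero vector of an eigenbasis lies in a listed eigenspace, so the list spans [V]; the
    [E i] are the projections of this sum. *)
Lemma ordering_grading (K : fieldType) (V : vectType K) (X : 'End(V)) Vs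
    (theta : seq K) :
  lfun_diagonalizable X -> eigenspace_ordering X Vs ->
  Vs = [seq passmx.leigenspace X a | a <- theta] ->
  exists E, eigen_grading X (size Vs) (nth 0%VS Vs) (nth 0 theta) E.
Proof.
move=> [b b_basis eig_b] [uVs VsP] Vs_eq.
pose n := size Vs.
have n_theta : size theta = n by rewrite /n Vs_eq size_map.
have sumV : {:V}%VS = (\sum_(i <- iota 0 n) nth 0%VS Vs i)%VS.
  apply/eqP; rewrite eq_sym eqEsubv subvf /= -(span_basis b_basis).
  apply/span_subvP => v bv; have [a Xv] := eig_b v bv.
  have [->|v0] := eqVneq v 0; first exact: mem0v.
  have a_v : v \in passmx.leigenspace X a by rewrite mem_leigenspace Xv.
  have /(nthP 0%VS)[i ltin Ui]: passmx.leigenspace X a \in Vs.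
    apply/VsP; exists a => //; apply/eqP => a0.
    by move: a_v v0; rewrite a0 memv0 => ->.
  rewrite (big_rem i) ?mem_iota //=; apply: subvP (addvSl _ _) _ _.
  by rewrite Ui.
exists (sumv_pi_for sumV); split.
(* A repeated value in [theta] would repeat an eigenspace in the duplicate-free [Vs]. *)
- move=> i j; rewrite !inE => lti ltj eq_th.
  have := nth_uniq 0%VS lti ltj uVs.
  by rewrite {1 2}Vs_eq !(nth_map 0) ?n_theta // eq_th eqxx => /esym/eqP.
- move=> i v; have [lein|ltin] := leqP n i.
    by rewrite nth_default // memv0 => /eqP ->; rewrite linear0 scaler0.
  by rewrite Vs_eq (nth_map 0) ?n_theta // mem_leigenspace => /eqP.
- by move=> i; apply: nth_default.
- by move=> i v; apply: memv_sum_pi.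
move=> v; rewrite -[RHS](sumv_pi_uniq_sum sumV) ?memvf //.
  by rewrite -(big_mkord predT (fun i => sumv_pi_for sumV i v)) /index_iota subn0.
by rewrite filter_predT iota_uniq.
Qed.

(** The part [y] cancels in the commutator because [X] acts on [y] and on [v] by the same scalar. At
    the last index [z] lies in the default 0, so the value [theta i.+1] there is harmless. *)
Lemma raises_lfun_comm (K : fieldType) (V : vectType K) (X Y : 'End(V)) Vs
    theta E :
  eigen_grading X (size Vs) (nth 0%VS Vs) theta E -> raises Y Vs ->
  forall i v, v \in nth 0%VS Vs i -> exists y z,
    [/\ y \in nth 0%VS Vs i, z \in nth 0%VS Vs i.+1, Y v = y + z
      & lfun_comm Y X v = (theta i - theta i.+1) *: z].
Proof.
move=> gr rY i v Uv.
have [lein|ltin] := leqP (size Vs) i.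
  exists 0, 0; rewrite !mem0v; move: Uv; rewrite nth_default // memv0 => /eqP ->.
  by rewrite !linear0 addr0.
have /memv_addP[y Uy [z Uz Yv]] : Y v \in (nth 0 Vs i + nth 0 Vs i.+1)%VS.
  apply: subvP (rY i _) _ (memv_img Y Uv).
  by rewrite /ordering_diam -ltnS prednK // (leq_trans _ ltin).
exists y, z; split=> //.
rewrite lfun_commE (grading_eigen gr Uv) linearZ /= Yv (linearD X) /=.
rewrite (grading_eigen gr Uy) (grading_eigen gr Uz) scalerDr opprD addrACA.
by rewrite subrr add0r scalerBl.
Qed.

Lemma raises_raising (K : fieldType) (V : vectType K) (X Y : 'End(V)) Vs
    theta E :
  eigen_grading X (size Vs) (nth 0%VS Vs) theta E -> raises Y Vs ->
  raising (lfun_comm Y X) (nth 0%VS Vs).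
Proof.
move=> gr rY i v Uv; have [y [z [_ Uz _ ->]]] := raises_lfun_comm gr rY Uv.
by rewrite rpredZ.
Qed.

Lemma comm_bij_inj (K : fieldType) (V : vectType K) (X Y : 'End(V)) Vs :
  comm_bij Y X Vs -> forall v, v \in nth 0%VS Vs 0 ->
  lfun_pow (lfun_comm Y X) (ordering_diam Vs) v = 0 -> v = 0.
Proof.
move=> /(_ 0%N (leq0n _))[_ inj] v Uv; rewrite double0 subn0 in inj => Nv0.
by apply: inj => //; rewrite ?mem0v // Nv0 linear0.
Qed.

(** With an empty list every vector would be an empty sum, against the positive dimension; listed
    subspaces belong to eigenvalues and so are nonzero. *)
Lemma ordering_head_neq0 (K : fieldType) (V : vectType K) (X : 'End(V)) Vs
    theta E :
  (0 < \dim {:V})%N -> eigenspace_ordering X Vs ->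
  eigen_grading X (size Vs) (nth 0%VS Vs) theta E ->
  size Vs = (ordering_diam Vs).+1 /\
  exists2 v, v \in nth 0%VS Vs 0 & v != 0.
Proof.
move=> dimV [_ VsP] gr.
have Vs_gt0 : (0 < size Vs)%N.
  rewrite lt0n; apply: contraTneq dimV => Vs0; rewrite lt0n negbK dimv_eq0.
  rewrite -subv0; apply/subvP => v _.
  by rewrite -(grading_sum gr v) Vs0 big_ord0 mem0v.
split; first by rewrite /ordering_diam prednK.
have /VsP[a a_eig Ua] := mem_nth 0%VS Vs_gt0.
by exists (vpick (nth 0%VS Vs 0)); rewrite ?memv_pick // vpick0 Ua.
Qed.

(** * Diameters and eigenvalue gaps for two members of a triad *)

Lemma standard_orderingC (K : fieldType) (V : vectType K) (X Y Z : 'End(V)) Vs :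
  standard_ordering X Y Z Vs -> standard_ordering X Z Y Vs.
Proof. by case=> ? [? ?] [? ?]. Qed.

(** Up to sign, [Y, X] raises the eigenspaces of [Y], so its power of exponent [size Ws] is 0,
    whereas its power of exponent [size Vs] - 1 is injective on the nonzero first eigenspace of [X].
    Exchanging [X] and [Y] gives equality. *)
Lemma standard_ordering_diam_le (K : fieldType) (V : vectType K)
    (X Y Z Z' : 'End(V)) Vs Ws :
  (0 < \dim {:V})%N -> lfun_diagonalizable X -> lfun_diagonalizable Y ->
  standard_ordering X Y Z Vs -> standard_ordering Y X Z' Ws ->
  (size Vs <= size Ws)%N.
Proof.
move=> dimV dX dY [oX [rY _] [bY _]] [oY [rX _] _].
have [th [Vs_eq _ _]] := eigenspace_ordering_eigenvalues oX.
have [et [Ws_eq _ _]] := eigenspace_ordering_eigenvalues oY.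
have [E grX] := ordering_grading dX oX Vs_eq.
have [F grY] := ordering_grading dY oY Ws_eq.
have [szV [v Uv v0]] := ordering_head_neq0 dimV oX grX.
rewrite szV ltnNge; apply: contra v0 => leWV; apply/eqP.
apply: (comm_bij_inj bY Uv); rewrite lfun_commC lfun_powZ scale_lfunE.
by rewrite (raising_pow_eq0 grY (raises_raising grY rX) _ leWV) scaler0.
Qed.

Lemma standard_ordering_gap_product (K : fieldType) (V : vectType K)
    (X Y Z Z' : 'End(V)) Vs Ws (theta eta : seq K) :
  (0 < \dim {:V})%N -> lfun_diagonalizable X -> lfun_diagonalizable Y ->
  standard_ordering X Y Z Vs -> standard_ordering Y X Z' Ws ->
  eigenvalue_seq X Vs theta -> eigenvalue_seq Y Ws eta ->
  size theta = size eta /\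
  forall i, (i.+1 < size theta)%N ->
    (theta`_i.+1 - theta`_i) * (eta`_i.+1 - eta`_i) =
    (theta`_1 - theta`_0) * (eta`_1 - eta`_0).
Proof.
move=> dimV dX dY sX sY Vs_eq Ws_eq.
have szVW : size Vs = size Ws.
  by apply/eqP; rewrite eqn_leq (standard_ordering_diam_le dimV dX dY sX sY)
    (standard_ordering_diam_le dimV dY dX sY sX).
have szV : size Vs = size theta by rewrite Vs_eq size_map.
have szW : size Ws = size eta by rewrite Ws_eq size_map.
split=> [|i]; first by rewrite -szV szVW.
case: sX sY => [oX [rY _] [bY _]] [oY [rX _] _].
have [E grX] := ordering_grading dX oX Vs_eq.
have [F grY] := ordering_grading dY oY Ws_eq.
have [szd [v Uv v0]] := ordering_head_neq0 dimV oX grX.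
have rU := raises_raising grX rY.
have rW : raising (lfun_comm Y X) (nth 0%VS Ws).
  move=> j w Uw; rewrite lfun_commC scale_lfunE rpredZ //.
  exact: raises_raising grY rX _ _ Uw.
rewrite -szV szd ltnS => ltid.
have gap j : (j < ordering_diam Vs)%N -> theta`_j - theta`_j.+1 != 0.
  move=> ltjd; rewrite subr_eq0; apply/eqP => /(grading_inj grX) eqj.
  have: j = j.+1 by apply: eqj; rewrite inE szd // ltnS ltnW.
  by move/eqP; rewrite -[j in j == _]addn0 -addn1 eqn_add2l.
(* By [raises_lfun_comm] the raising part of [Y] on V_j is [Y, X] divided by theta_j - theta_(j+1).
   This reciprocal serves as [delta], and clearing it turns [eigenvalue_gap_product] into the
   identity between products of gaps. *)
have Ydelta j x : (j < ordering_diam Vs)%N -> x \in nth 0%VS Vs j ->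
    Y x - (theta`_j - theta`_j.+1)^-1 *: lfun_comm Y X x \in nth 0%VS Vs j.
  move=> ltjd Ux; have [y [z [Uy _ -> ->]]] := raises_lfun_comm grX rY Ux.
  by rewrite scalerK ?gap // addrK.
have grX' := grX; have grY' := grY; rewrite -szVW in grY'; rewrite szd in grX' grY'.
have := eigenvalue_gap_product grX' grY' rU rW Ydelta (comm_bij_inj bY) Uv v0 ltid.
have := gap i ltid; have := gap 0%N (leq_ltn_trans (leq0n _) ltid).
move=> g0 gi /(canRL (divfK g0)) ->.
rewrite -[theta`_i.+1 - _]opprB -[theta`_1 - _]opprB !mulNr -mulrA mulVKf //.
by rewrite mulrC.
Qed.

(** * Invariance of the triad conditions under affine equivalence *)

Lemma affine_equivE (K : fieldType) (V : vectType K) (X B : 'End(V)) r s v :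
  X = r *: B + s *: \1%VF -> X v = r *: B v + s *: v.
Proof. by move=> ->; rewrite add_lfunE !scale_lfunE id_lfunE. Qed.

Lemma affine_equiv_eigenspace (K : fieldType) (V : vectType K) (X B : 'End(V))
    r s a : r != 0 -> X = r *: B + s *: \1%VF ->
  passmx.leigenspace B a = passmx.leigenspace X (r * a + s).
Proof.
move=> r0 XB; apply/vspaceP => v; rewrite !mem_leigenspace (affine_equivE v XB).
rewrite scalerDl (inj_eq (addIr _)) -scalerA.
by rewrite (inj_eq (can_inj (scalerK r0))).
Qed.

Lemma affine_equiv_diagonalizable (K : fieldType) (V : vectType K)
    (X B : 'End(V)) :
  affine_equiv X B -> lfun_diagonalizable X -> lfun_diagonalizable B.
Proof.
move=> [r [s [r0 XB]]] [b b_basis eig_b]; exists b => // v bv.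
have [a /eqP] := eig_b v bv; rewrite -mem_leigenspace => Xa.
exists (r^-1 * (a - s)); apply/eqP; rewrite -mem_leigenspace.
by rewrite (affine_equiv_eigenspace _ r0 XB) mulVKf ?subrK.
Qed.

Lemma affine_equiv_eigenspace_ordering (K : fieldType) (V : vectType K)
    (X B : 'End(V)) Vs :
  affine_equiv X B -> eigenspace_ordering X Vs -> eigenspace_ordering B Vs.
Proof.
move=> [r [s [r0 XB]]] [uVs VsP]; split=> // U; rewrite VsP.
split=> [] [a]; rewrite /passmx.leigenvalue => eig_a ->.
  exists (r^-1 * (a - s));
  by rewrite /passmx.leigenvalue (affine_equiv_eigenspace _ r0 XB) mulVKf ?subrK.
by exists (r * a + s); rewrite /passmx.leigenvalue -(affine_equiv_eigenspace a r0 XB).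
Qed.

Lemma affine_equiv_raises (K : fieldType) (V : vectType K) (Y B : 'End(V)) Vs :
  affine_equiv Y B -> raises Y Vs -> raises B Vs.
Proof.
move=> [r [s [r0 YB]]] rY i lei; apply/subvP => _ /memv_imgP[v Uv ->].
have -> : B v = r^-1 *: (Y v - s *: v).
  by rewrite (affine_equivE v YB) addrK scalerK.
rewrite rpredZ // rpredB //; first by rewrite (subvP (rY i lei)) ?memv_img.
by rewrite rpredZ // (subvP (addvSl _ _)).
Qed.

(** Scalar shifts commute with everything, so only the product of the two scaling factors is
    left. *)
Lemma affine_equiv_comm (K : fieldType) (V : vectType K) (X Y B C : 'End(V)) :
  affine_equiv X B -> affine_equiv Y C ->
  exists2 c : K, c != 0 & lfun_comm C B = c *: lfun_comm Y X.
Proof.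
move=> [r [s [r0 XB]]] [t [u [t0 YC]]]; exists (r * t)^-1.
  by rewrite invr_neq0 ?mulf_neq0.
apply/lfunP => v; apply: (can_inj (scalerK (mulf_neq0 r0 t0))).
rewrite scale_lfunE scalerKV ?mulf_neq0 // !lfun_commE.
(* Both composites are expanded so that everything beyond the leading term is literally the same and
   cancels in the difference. *)
have -> : Y (X v) = (r * t) *: C (B v)
    + ((r * u) *: B v + ((s * t) *: C v + (s * u) *: v)).
  rewrite (affine_equivE v XB) linearD !linearZ /= !(affine_equivE _ YC).
  by rewrite !scalerDr !scalerA -addrA.
have -> : X (Y v) = (r * t) *: B (C v)
    + ((r * u) *: B v + ((s * t) *: C v + (s * u) *: v)).
  rewrite (affine_equivE v YC) linearD !linearZ /= !(affine_equivE _ XB).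
  rewrite !scalerDr !scalerA -addrA [t * r]mulrC [t * s]mulrC.
  by rewrite [u * r]mulrC [u * s]mulrC [_ + (_ *: B v + _)]addrCA.
by rewrite opprD addrACA subrr addr0 -scalerBr.
Qed.

(** The powers of the two commutators differ by a nonzero scalar, which changes neither the image of
    a subspace nor injectivity. *)
Lemma affine_equiv_comm_bij (K : fieldType) (V : vectType K)
    (X Y B C : 'End(V)) Vs :
  affine_equiv X B -> affine_equiv Y C -> comm_bij Y X Vs -> comm_bij C B Vs.
Proof.
move=> XB YC bYX i lei; have [c c0 ->] := affine_equiv_comm XB YC.
have [im_eq inj] := bYX i lei; rewrite lfun_powZ.
set k := (_ - _)%N in im_eq inj *; have ck0 : c ^+ k != 0 by rewrite expf_neq0.
split=> [|v w Uv Uw]; last first.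
  by rewrite !scale_lfunE => /(can_inj (scalerK ck0)); apply: inj.
rewrite -im_eq; apply/vspaceP => v; apply/memv_imgP/memv_imgP.
  by case=> w Uw ->; exists (c ^+ k *: w); rewrite ?rpredZ // scale_lfunE linearZ.
case=> w Uw ->; exists ((c ^+ k)^-1 *: w); first by rewrite rpredZ.
by rewrite scale_lfunE linearZ /= scalerKV.
Qed.

Lemma affine_equiv_standard_ordering (K : fieldType) (V : vectType K)
    (X Y Z B C D : 'End(V)) Vs :
  affine_equiv X B -> affine_equiv Y C -> affine_equiv Z D ->
  standard_ordering X Y Z Vs -> standard_ordering B C D Vs.
Proof.
move=> XB YC ZD [oX [rY rZ] [bY bZ]]; split.
- exact: affine_equiv_eigenspace_ordering oX.
- by split; [apply: affine_equiv_raises rY | apply: affine_equiv_raises rZ].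
by split; [apply: affine_equiv_comm_bij bY | apply: affine_equiv_comm_bij bZ].
Qed.

(** * Arithmetic progressions and their rescaling *)

Lemma seq_gap_neq0 (K : fieldType) (theta : seq K) i :
  uniq theta -> (i.+1 < size theta)%N -> theta`_i.+1 - theta`_i != 0.
Proof.
move=> uth lti; rewrite subr_eq0 nth_uniq ?(ltnW lti) //.
by rewrite -[i in _ == i]addn0 -addn1 eqn_add2l.
Qed.

Lemma arithmetic_of_sqr_gaps (K : fieldType) (theta : seq K) :
  uniq theta ->
  (forall i, (i.+1 < size theta)%N ->
    (theta`_i.+1 - theta`_i) ^+ 2 = (theta`_1 - theta`_0) ^+ 2) ->
  forall i, (i < size theta)%N ->
  theta`_i = theta`_0 + i%:R * (theta`_1 - theta`_0).
Proof.
move=> uth sqr_gap.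
have gap i : (i.+1 < size theta)%N ->
    theta`_i.+1 - theta`_i = theta`_1 - theta`_0.
  elim: i => // i IHi lti; have gapi := IHi (ltnW lti).
  have /eqP := sqr_gap _ lti; rewrite eqf_sqr => /orP[/eqP //|].
  (* Opposite consecutive gaps would give theta_(i+2) = theta_i, against [uniq theta]. *)
  rewrite -gapi opprB -subr_eq0 opprB addrA subrK subr_eq0 nth_uniq //.
    by rewrite eqn_leq ltnNge leqnSn.
  by rewrite (ltn_trans _ lti).
elim=> [|i IHi] lti; first by rewrite mul0r addr0.
by rewrite -(subrK theta`_i theta`_i.+1) gap // IHi ?(ltnW lti) // -natr1; ring.
Qed.

Lemma arithmetic_affine_rescale (K : fieldType) (theta : seq K) d :
  [pchar K] =i pred0 -> size theta = d.+1 -> uniq theta ->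
  (forall i, (i < size theta)%N ->
    theta`_i = theta`_0 + i%:R * (theta`_1 - theta`_0)) ->
  exists r s : K, r != 0 /\
    theta = [seq r * a + s | a <- mkseq (fun i => (i.*2)%:R - d%:R) d.+1].
Proof.
move=> charK0 szth uth arith.
have two0 : 2%:R != 0 :> K.
  by have := charK0 2; rewrite !inE /= => /negbT.
have [g g0 thE] : exists2 g : K, g != 0 &
    forall i, (i < d.+1)%N -> theta`_i = theta`_0 + i%:R * g.
  (* For d = 0 the entry theta_1 is the default 0 and theta_1 - theta_0 may vanish; any nonzero [g]
     then works, here 1. *)
  case: d szth => [|d] szth.
    by exists 1 => [|[|//] _]; rewrite ?oner_neq0 ?mul0r ?addr0.
  exists (theta`_1 - theta`_0); first by rewrite seq_gap_neq0 // szth.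
  by move=> i lti; rewrite arith // szth.
(* Solves r (2i - d) + s = theta_0 + i g for all i; characteristic zero makes 2 invertible. *)
exists (g / 2%:R), (theta`_0 + d%:R * (g / 2%:R)).
split; first by rewrite mulf_neq0 ?invr_neq0.
apply: (@eq_from_nth _ 0); first by rewrite size_map size_mkseq szth.
move=> i; rewrite szth => lti; rewrite (nth_map 0) ?size_mkseq // nth_mkseq //.
by rewrite thE // -mul2n natrM; field.
Qed.

(** * Constant squared gaps and the construction of the reduced triad *)

Lemma standard_orderings_sqr_gaps (K : fieldType) (V : vectType K)
    (A A' A'' : 'End(V)) Vs Vs' Vs'' (theta theta' theta'' : seq K) :
  (0 < \dim {:V})%N ->
  lfun_diagonalizable A -> lfun_diagonalizable A' -> lfun_diagonalizable A'' ->
  standard_orderings A A' A'' Vs Vs' Vs'' ->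
  eigenvalue_seq A Vs theta -> eigenvalue_seq A' Vs' theta' ->
  eigenvalue_seq A'' Vs'' theta'' -> uniq theta' -> uniq theta'' ->
  size theta = size theta' /\
  forall i, (i.+1 < size theta)%N ->
    (theta`_i.+1 - theta`_i) ^+ 2 = (theta`_1 - theta`_0) ^+ 2.
Proof.
move=> dimV dA dA' dA'' [sA sA' sA''] eA eA' eA'' uth' uth''.
have [sz1 g1] := standard_ordering_gap_product dimV dA dA' sA
  (standard_orderingC sA') eA eA'.
have [sz2 g2] := standard_ordering_gap_product dimV dA' dA'' sA'
  (standard_orderingC sA'') eA' eA''.
have [sz3 g3] := standard_ordering_gap_product dimV dA'' dA sA''
  (standard_orderingC sA) eA'' eA.
split=> // i lti.
have lti' : (i.+1 < size theta')%N by rewrite -sz1.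
have lti'' : (i.+1 < size theta'')%N by rewrite sz3.
have := g1 i lti; have := g2 i lti'; have := g3 i lti''.
have := seq_gap_neq0 uth' lti'; have := seq_gap_neq0 uth'' lti''.
move: (_ - theta`_i) (_ - theta'`_i) (_ - theta''`_i) (_ - theta`_0)
  (_ - theta'`_0) (_ - theta''`_0).
move=> a b c a0 b0 c0 c_neq0 b_neq0 eca ebc eab.
(* With ab = a0 b0, bc = b0 c0 and ca = c0 a0, the product (ab)(ca) equals both a^2 bc and a0^2 bc;
   then the nonzero bc is cancelled. *)
apply: (mulIf (mulf_neq0 b_neq0 c_neq0)); rewrite [in RHS]ebc.
transitivity ((a * b) * (c * a)); first by ring.
by rewrite eab eca; ring.
Qed.

Theorem theorem4p3 (K : closedFieldType) (charK0 : [pchar K] =i pred0)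
    (V : vectType K) (dimV_gt0 : (0 < \dim {:V})%N)
    (A A' A'' : 'End(V)) :
  BD_triad A A' A'' ->
  exists B B' B'' : 'End(V),
    reduced_BD_triad B B' B'' /\ triad_affine_equiv A A' A'' B B' B''.
Proof.
case=> dA dA' dA'' [Vs [Vs' [Vs'' sAs]]]; have [sA sA' sA''] := sAs.
have [[oA _ _] [oA' _ _] [oA'' _ _]] := sAs.
have [th [eA uth _]] := eigenspace_ordering_eigenvalues oA.
have [th' [eA' uth' _]] := eigenspace_ordering_eigenvalues oA'.
have [th'' [eA'' uth'' _]] := eigenspace_ordering_eigenvalues oA''.
have [sz gaps] := standard_orderings_sqr_gaps dimV_gt0 dA dA' dA'' sAs
  eA eA' eA'' uth' uth''.
(* The conditions on a triad are invariant under cyclic rotation, which yields the squared gaps of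
   the other two members. *)
have [sz' gaps'] := standard_orderings_sqr_gaps dimV_gt0 dA' dA'' dA
  (And3 sA' sA'' sA) eA' eA'' eA uth'' uth.
have [_ gaps''] := standard_orderings_sqr_gaps dimV_gt0 dA'' dA dA'
  (And3 sA'' sA sA') eA'' eA eA' uth uth'.
pose d := ordering_diam Vs.
have szd : size th = d.+1.
  have [E gr] := ordering_grading dA oA eA.
  by have [<- _] := ordering_head_neq0 dimV_gt0 oA gr; rewrite eA size_map.
(* Solving X = r B + s for B keeps every eigenspace in its place in the list and only relabels the
   eigenvalues, so the orderings of the given triad are reused for the new one. *)
have rescale (X : 'End(V)) Ws eta : size eta = d.+1 -> uniq eta ->
    (forall i, (i.+1 < size eta)%N ->
      (eta`_i.+1 - eta`_i) ^+ 2 = (eta`_1 - eta`_0) ^+ 2) ->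
    eigenvalue_seq X Ws eta ->
    exists2 B, affine_equiv X B &
      eigenvalue_seq B Ws (mkseq (fun i => (i.*2)%:R - d%:R : K) d.+1).
  move=> sz_eta u_eta gaps_eta eX.
  have [r [s [r0 eta_eq]]] := arithmetic_affine_rescale charK0 sz_eta u_eta
    (arithmetic_of_sqr_gaps u_eta gaps_eta).
  have XB : X = r *: (r^-1 *: (X - s *: \1%VF)) + s *: \1%VF.
    by rewrite scalerKV // subrK.
  exists (r^-1 *: (X - s *: \1%VF)); first by exists r, s.
  rewrite /eigenvalue_seq eX eta_eq -map_comp; apply: eq_map => a /=.
  by rewrite (affine_equiv_eigenspace _ r0 XB).
have [B AB eB] := rescale A Vs th szd uth gaps eA.
have [B' AB' eB'] := rescale A' Vs' th' (etrans (esym sz) szd) uth' gaps' eA'.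
have [B'' AB'' eB''] := rescale A'' Vs'' th''
  (etrans (esym sz') (etrans (esym sz) szd)) uth'' gaps'' eA''.
have sBs : standard_orderings B B' B'' Vs Vs' Vs''.
  by split; [apply: affine_equiv_standard_ordering sA
            | apply: affine_equiv_standard_ordering sA'
            | apply: affine_equiv_standard_ordering sA''].
exists B, B', B''; split; last by split.
split; last by exists Vs, Vs', Vs'', d.
split; last by exists Vs, Vs', Vs''.
- exact: affine_equiv_diagonalizable dA.
- exact: affine_equiv_diagonalizable dA'.
exact: affine_equiv_diagonalizable dA''.
Qed.
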